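(* Let $g_1:\mathbb R\to\mathbb R$ be continuous and non-affine, and let $g_2:\mathbb R\to\mathbb R$ be given by $g_2(t)=1-\frac{t}{2}$. Let $\mathcal S$ be the class of all functions $\mathbb R\to\mathbb R$ obtained from $g_1$ and $g_2$ by repeated addition and composition. Then, for every compact set $K\subset\mathbb R$, every function in $C(K)$ can be uniformly approximated on $K$ by functions from $\mathcal S$; that is, for every $f\in C(K)$ and every $\varepsilon>0$ there exists $F\in\mathcal S$ such that $\sup_{x\in K}|f(x)-F(x)|<\varepsilon$.
   Context: A function $g:\mathbb R\to\mathbb R$ is affine if it has the form $g(t)=at+b$ with $a,b\in\mathbb R$ (including constant functions), and non-affine otherwise. $C(K)$ denotes the space of real-valued continuous functions on $K$ with the uniform norm. The class of functions obtained from $g_1$ and $g_2$ by repeated addition and composition is the smallest set $\mathcal S$ of functions $\mathbb R\to\mathbb R$ such that $g_1,g_2\in\mathcal S$ and, whenever $f,h\in\mathcal S$, also $f+h\in\mathcal S$ (pointwise sum) and $f\circ h\in\mathcal S$. Multiplication by constants is not assumed, and the identity function and constant functions are not assumed to be in $\mathcal S$ a priori. *)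

(* Defs.v *)
From HB Require Import structures.
From mathcomp Require Import all_boot all_order all_algebra.
From mathcomp Require Import boolp classical_sets reals ereal topology normedtype.

Set Implicit Arguments.
Unset Strict Implicit.
Unset Printing Implicit Defensive.

Import Order.TTheory GRing.Theory Num.Theory.
Import numFieldNormedType.Exports.

Local Open Scope classical_set_scope.
Local Open Scope ring_scope.

Definition affine (R : realType) (g : R -> R) : Prop :=
  exists a b : R, forall t : R, g t = a * t + b.

Definition add_comp_closed (R : realType) (S : set (R -> R)) : Prop :=
  (forall f h, S f -> S h -> S (f \+ h)) /\
  (forall f h, S f -> S h -> S (f \o h)).

Definition add_comp_class (R : realType) (g1 g2 : R -> R) : set (R -> R) :=
  smallest (@add_comp_closed R) [set g1; g2].

(* The supremum is taken in the extended reals, so that it is meaningful without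
   a boundedness side condition; it is -oo when K is empty. *)
Definition unif_dist (R : realType) (K : set R) (f F : R -> R) : \bar R :=
  ereal_sup [set (`|f x - F x|)%:E | x in K].

(* Main.v *)
Require Import Defs.
From mathcomp Require Import all_boot all_order all_algebra.
From mathcomp Require Import boolp classical_sets functions reals ereal topology normedtype.
From mathcomp Require Import lra ring.

Set Implicit Arguments.
Unset Strict Implicit.
Unset Printing Implicit Defensive.

Import Order.TTheory GRing.Theory Num.Theory.
Import numFieldNormedType.Exports.

Local Open Scope classical_set_scope.
Local Open Scope ring_scope.

(** Write T for the closure of S, the class generated by g1 and g2, under
    uniform convergence on bounded sets.  From 1 - t/2 alone, addition and
    composition yield t/2, 1, t and -t, hence all dyadic constants and all
    dyadic multiples of t; by density T contains every affine function.
    Because the elements of S are continuous, T is still stable under addition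
    and composition ([luc_closure_approx_class]).  So T is a vector space,
    invariant under affine changes of variable, which also allows composition.

    A non-affine continuous g has a nonzero second difference, and this puts
    t^2 in T ([approx_sqr]).  Morally one smooths g by averaging its translates
    over an interval twice; the second derivative of the result is a second
    difference of g, so it is continuous and nonzero somewhere, and blowing up
    around such a point exhibits t^2 as a limit of affine modifications.  The
    averages used here are finite ones, over N equally spaced translates: their
    second differences of step 1/N telescope exactly to 1/N^2 times a second
    difference of g, and a discrete Taylor estimate replaces the usual one
    ([approx_local_square]).

    Composing with squares, the iteration p <- p + (t^2 - p^2)/2 gives |t|
    ([approx_abs]), so T is stable under minima.  A continuous f on a compact K
    is, up to any given error, the minimum of finitely many steep cones
    f(x) + L |y - x|, which lie in T ([approx_compact]). *)

(** * Uniform continuity, boundedness and density on the real line *)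

Lemma continuous_eps_delta (R : realType) (f : R -> R) (x e : R) :
  {for x, continuous f} -> 0 < e ->
  exists2 d, 0 < d & forall y, `|x - y| < d -> `|f x - f y| < e.
Proof.
move=> cf e0; have /cvgrPdist_lt /(_ e e0) := cf.
by move=> /nbhs_ballP[d /= d0 dP]; exists d => // y xy; exact: dP.
Qed.

(** Only x has to lie in the compact set, so two nearby points of a segment need
    not both be checked to lie in it. *)
Lemma continuous_compact_unif (R : realType) (K : set R) (f : R -> R) (e : R) :
  continuous f -> compact K -> 0 < e ->
  exists2 d, 0 < d & forall x y, K x -> `|x - y| < d -> `|f x - f y| <= e.
Proof.
move=> cf cK e0.
have e20 : 0 < e / 2 by rewrite divr_gt0.
move/compact_near_coveringP: cK =>
  /(_ _ (0^'+) (fun d x => forall y, `|x - y| < d -> `|f x - f y| <= e) _).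
case.
  move=> x Kx; have [d d0 dP] := @continuous_eps_delta _ _ x _ (cf x) e20.
  have d20 : 0 < d / 2 by rewrite divr_gt0.
  exists ([set x' | `|x - x'| < d / 2], [set r | r < d / 2]) => /=.
    split; first by apply/nbhs_ballP; exists (d / 2).
    exact: nbhs_right_lt.
  move=> [x' r] /= [xx' rd] y x'y; rewrite /= in xx' rd.
  have h1 := dP x' ltac:(lra).
  have h2 : `|f x - f y| < e / 2.
    apply: dP; have := ler_distD x' x y; lra.
  have := ler_distD (f x) (f x') (f y); rewrite (distrC (f x') (f x)); lra.
move=> d /= d0 H; exists (d / 2); first by rewrite divr_gt0.
move=> x y Kx; apply: (H (d / 2)) => //=; last by rewrite divr_gt0.
by rewrite sub0r normrN gtr0_norm; lra.
Qed.

Lemma segment_bounded (R : realType) (f : R -> R) (M : R) :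
  continuous f -> exists B, forall x, `|x| <= M -> `|f x| <= B.
Proof.
move=> cf.
have : compact (f @` `[- M, M]).
  apply: continuous_compact; last exact: segment_compact.
  exact: continuous_subspaceT.
move=> /compact_bounded [B [_ /(_ (B + 1))]]; rewrite ltrDl ltr01 => /(_ isT) H.
by exists (B + 1) => x xM; apply: H; exists x => //=; rewrite in_itv /= -ler_norml.
Qed.

(** Such a P contains all dyadic numbers k / 2^n. *)
Lemma halving_dense (R : realType) (P : set R) :
  P 1 -> (forall a b, P a -> P b -> P (a - b)) -> (forall a, P a -> P (a / 2)) ->
  forall x e : R, 0 < e -> exists2 a, P a & `|x - a| <= e.
Proof.
move=> P1 PB Ph x e e0.
have P0 : P 0 by rewrite -(subrr 1); exact: PB.
have PN a : P a -> P (- a) by rewrite -sub0r; exact: PB.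
have PD a b : P a -> P b -> P (a + b).
  by move=> Pa /PN Pb; rewrite -[b]opprK; exact: PB.
have Pn n a : P a -> P (a *+ n).
  by move=> Pa; elim: n => [|n IH]; rewrite ?mulr0n // mulrS; exact: PD.
have Pz (z : int) a : P a -> P (a *~ z).
  by move=> Pa; case: z => n /=; [exact: Pn | apply/PN/Pn].
have P2 n : P (2 ^- n).
  elim: n => [|n IH]; first by rewrite expr0 invr1.
  by rewrite exprSr invfM; apply: Ph.
(* 2^n > n, so any n above 1/e will do. *)
have [n ne] : exists n : nat, 2 ^- n <= e.
  exists (Num.truncn e^-1).+1.
  rewrite -[leRHS]invrK lef_pV2 ?posrE ?invr_gt0 ?exprn_gt0 //.
  apply: ltW; apply: (lt_le_trans (truncnS_gt _)).
  by rewrite -natrX ler_nat ltnW // ltn_expl.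
have n0 : 0 < 2 ^+ n :> R by rewrite exprn_gt0.
exists (2 ^- n *~ Num.floor (x * 2 ^+ n)); first exact/Pz/P2.
have := floor_itv (x * 2 ^+ n); rewrite intrD mulr1z.
set z := Num.floor _ => /andP[h1 h2].
apply: le_trans ne; rewrite -mulrzr; set k := z%:~R in h1 h2 *.
have -> : x - 2 ^- n * k = 2 ^- n * (x * 2 ^+ n - k) by field; rewrite gt_eqF.
rewrite normrM gtr0_norm ?invr_gt0 // ler_piMr ?invr_ge0 ?ltW //.
rewrite ger0_norm; lra.
Qed.

(** * Closure under uniform convergence on bounded sets *)

(** The closure of S in the topology of locally uniform convergence. *)
Definition luc_closure (R : realType) (S : set (R -> R)) : set (R -> R) :=
  [set f | forall M e : R, 0 < e ->
    exists2 F, S F & forall x, `|x| <= M -> `|f x - F x| <= e].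

(** The stability properties from which density of T on compact sets will be
    derived; they isolate all that the rest of the argument uses of S. *)
Record approx_class (R : realType) (T : set (R -> R)) : Prop := ApproxClass {
  approx_add : forall f h, T f -> T h -> T (f \+ h);
  approx_comp : forall f h, T f -> T h -> T (f \o h);
  approx_affine : forall a b : R, T (fun x => a * x + b);
  approx_closed : luc_closure T `<=` T }.

Lemma subset_luc_closure (R : realType) (S : set (R -> R)) : S `<=` luc_closure S.
Proof. by move=> f Sf M e e0; exists f => // x _; rewrite subrr normr0 ltW. Qed.

Lemma luc_closure_idem (R : realType) (S : set (R -> R)) :
  luc_closure (luc_closure S) `<=` luc_closure S.
Proof.
move=> f cf M e e0; have e20 : 0 < e / 2 by rewrite divr_gt0.
have [F SF fF] := cf M _ e20; have [G SG FG] := SF M _ e20.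
exists G => // x xM; have := ler_distD (F x) (f x) (G x).
have := fF x xM; have := FG x xM; lra.
Qed.

Lemma luc_closure_add (R : realType) (S : set (R -> R)) :
  (forall f h, S f -> S h -> S (f \+ h)) ->
  forall f h, luc_closure S f -> luc_closure S h -> luc_closure S (f \+ h).
Proof.
move=> SD f h cf ch M e e0; have e20 : 0 < e / 2 by rewrite divr_gt0.
have [F SF fF] := cf M _ e20; have [H SH hH] := ch M _ e20.
exists (F \+ H); first exact: SD.
move=> x xM /=; rewrite opprD addrACA.
apply: le_trans (ler_normD _ _) _; have := fF x xM; have := hH x xM; lra.
Qed.

(** For f \o h, first approximate f on a bounded set containing a neighbourhood
    of the values of h; the approximant F being uniformly continuous there, h
    can then be approximated finely enough for F not to notice. *)
Lemma luc_closure_comp (R : realType) (S : set (R -> R)) :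
  (forall f, S f -> continuous f) ->
  (forall f h, S f -> S h -> S (f \o h)) ->
  forall f h, luc_closure S f -> luc_closure S h -> luc_closure S (f \o h).
Proof.
move=> Sc SC f h cf ch M e e0; have e20 : 0 < e / 2 by rewrite divr_gt0.
(* Any approximant of h within 1 shows that h is bounded on [-M, M]. *)
have [H1 SH1 hH1] := ch M _ ltr01.
have [B HB] := segment_bounded M (Sc _ SH1).
have hB x : `|x| <= M -> `|h x| <= B + 1.
  move=> xM; have -> : h x = H1 x + (h x - H1 x) by ring.
  by apply: le_trans (ler_normD _ _) _; rewrite lerD ?HB ?hH1.
have [F SF fF] := cf (B + 1) _ e20.
have [d d0 dP] := continuous_compact_unif (Sc _ SF)
  (@segment_compact _ (- (B + 1)) (B + 1)) e20.
have d20 : 0 < d / 2 by rewrite divr_gt0.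
have [H SH hH] := ch M _ d20.
exists (F \o H); first exact: SC.
move=> x xM /=; have hx := hB x xM.
have h1 := fF _ hx.
have h2 : `|F (h x) - F (H x)| <= e / 2.
  apply: dP; first by rewrite /= in_itv /= -ler_norml.
  have := hH x xM; lra.
have := ler_distD (F (h x)) (f (h x)) (F (H x)); lra.
Qed.

(** The constants of S, and likewise the slopes of the linear functions of S,
    form a set stable under subtraction and halving, hence dense. *)
Lemma luc_closure_approx_class (R : realType) (S : set (R -> R)) :
  (forall f, S f -> continuous f) -> add_comp_closed S ->
  S (fun x => x / 2) -> S (cst 1) -> S (fun x => - x) ->
  approx_class (luc_closure S).
Proof.
move=> Sc [SD SC] S2 S1 SN; split; last exact: luc_closure_idem.
- exact: luc_closure_add.
- exact: luc_closure_comp.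
have Sid : S id.
  rewrite (_ : id = (fun x => x / 2) \+ (fun x => x / 2)); first exact: SD.
  by apply/funext => x; rewrite /cst /=; lra.
have SB f h : S f -> S h -> S (f \- h).
  by move=> Sf Sh; exact: SD Sf (SC _ _ SN Sh).
have Sh f : S f -> S (fun x => f x / 2) by move=> Sf; exact: SC S2 Sf.
move=> a b M e e0; have e20 : 0 < e / 2 by rewrite divr_gt0.
have M0 : 0 < `|M| + 1 by rewrite ltr_wpDl.
have [b' Sb bb] : exists2 c, S (cst c) & `|b - c| <= e / 2.
  apply: (halving_dense (P := [set c | S (cst c)])) => //= c; first by move=> d; exact: SB.
  exact: Sh.
have eM : 0 < e / 2 / (`|M| + 1) by rewrite divr_gt0.
have [a' Sa aa] : exists2 c, S (fun x => c * x) & `|a - c| <= e / 2 / (`|M| + 1).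
  apply: (halving_dense (P := [set c | S (fun x => c * x)])) => //=.
  - by rewrite (_ : (fun x => _) = id) //; apply/funext => x; rewrite mul1r.
  - move=> c d Sx Sy.
    rewrite (_ : (fun x => _) = (fun x => c * x) \- (fun x => d * x)); first exact: SB.
    by apply/funext => x /=; rewrite mulrBl.
  - move=> c Sx; rewrite (_ : (fun x => _) = (fun x => c * x / 2)); first exact: Sh.
    by apply/funext => x /=; rewrite mulrAC.
exists (fun x => a' * x + b'); first exact: SD Sa Sb.
move=> x xM; have -> : a * x + b - (a' * x + b') = (a - a') * x + (b - b') by ring.
apply: le_trans (ler_normD _ _) _; rewrite normrM.
have : `|a - a'| * `|x| <= e / 2 / (`|M| + 1) * (`|M| + 1).
  by apply: ler_pM => //; have := ler_norm M; lra.
rewrite divfK ?gt_eqF //; lra.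
Qed.

Lemma add_comp_class_closed (R : realType) (g1 g2 : R -> R) :
  add_comp_closed (add_comp_class g1 g2).
Proof.
split=> f h Sf Sh X CX; case: (CX) => -[XD XC] _.
- exact: XD (Sf X CX) (Sh X CX).
- exact: XC (Sf X CX) (Sh X CX).
Qed.

Lemma add_comp_class_continuous (R : realType) (g1 g2 : R -> R) :
  continuous g1 -> continuous g2 ->
  forall f, add_comp_class g1 g2 f -> continuous f.
Proof.
move=> c1 c2 f; apply: (smallest_sub (X := [set f | continuous f])).
  split=> F H cF cH /= x; first by apply: cvgD; [exact: cF | exact: cH].
  by apply: continuous_comp; [exact: cH | exact: cF].
by move=> _ [->|->].
Qed.

(** The three generators t/2, 1 and -t come from 2 - t = g2 + g2,
    t/2 = g2 (2 - t), 1 = g2 + t/2, -1 = g2 4 and -t = (2 - t) - 1 - 1. *)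
Lemma add_comp_class_approx_class (R : realType) (g1 g2 : R -> R) :
  continuous g1 -> (forall t, g2 t = 1 - t / 2) ->
  approx_class (luc_closure (add_comp_class g1 g2)).
Proof.
move=> cg1 hg2; set S := add_comp_class g1 g2.
have [SD SC] : add_comp_closed S by exact: add_comp_class_closed.
have Sg2 : S g2 by apply: sub_gen_smallest; right.
have S2B : S (fun x => 2 - x).
  rewrite (_ : (fun x => _) = g2 \+ g2); first exact: SD.
  by apply/funext => x; rewrite /cst /= ?hg2; lra.
have S2 : S (fun x => x / 2).
  rewrite (_ : (fun x => _) = g2 \o (fun x => 2 - x)); first exact: SC.
  by apply/funext => x; rewrite /cst /= ?hg2; lra.
have S1 : S (cst 1).
  rewrite (_ : cst 1 = g2 \+ (fun x => x / 2)); first exact: SD.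
  by apply/funext => x; rewrite /cst /= ?hg2; lra.
have SN1 : S (cst (-1)).
  rewrite (_ : cst (-1) = g2 \o ((cst 1 \+ cst 1) \+ (cst 1 \+ cst 1))).
    exact: SC Sg2 (SD _ _ (SD _ _ S1 S1) (SD _ _ S1 S1)).
  by apply/funext => x; rewrite /cst /= ?hg2; lra.
apply: luc_closure_approx_class => //.
- apply: add_comp_class_continuous => //.
  rewrite (_ : g2 = fun t => 1 - t / 2); last exact/funext.
  move=> x; apply: cvgB; first exact: cvg_cst.
  by apply: cvgMl; exact: cvg_id.
- rewrite (_ : (fun x => _) = (fun x => 2 - x) \+ (cst (-1) \+ cst (-1))).
    exact: SD S2B (SD _ _ SN1 SN1).
  by apply/funext => x; rewrite /cst /=; lra.
Qed.

(** * Second differences *)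

(** If all second differences of g vanish, subtract from g the affine function
    agreeing with it at 0 and 1.  The difference e is additive and vanishes at
    1, so its zeros are stable under subtraction and halving; they are dense,
    and e = 0 by continuity. *)
Lemma exists_second_difference_neq0 (R : realType) (g : R -> R) :
  continuous g -> ~ affine g ->
  exists t h, g (t + 2 * h) - 2 * g (t + h) + g t != 0.
Proof.
move=> cg; apply: contra_notP => /forallNP H.
have {}H t h : g (t + 2 * h) - 2 * g (t + h) + g t = 0.
  by have /forallNP/(_ h)/negP/negPn/eqP := H t.
pose e t := g t - ((g 1 - g 0) * t + g 0).
have He t h : e (t + 2 * h) - 2 * e (t + h) + e t = 0.
  by rewrite -[RHS](H t h) /e; ring.
have e0 : e 0 = 0 by rewrite /e; ring.
have e1 : e 1 = 0 by rewrite /e; ring.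
have eh x : 2 * e (x / 2) = e x.
  have := He 0 (x / 2); rewrite !add0r e0 mulrC divfK ?pnatr_eq0 //; lra.
have eD x y : e (x + y) = e x + e y.
  have := He x ((y - x) / 2).
  rewrite (_ : x + 2 * _ = y); last by field.
  rewrite (_ : x + _ / 2 = (x + y) / 2); last by field.
  rewrite eh; lra.
exists (g 1 - g 0), (g 0) => t; apply/eqP; rewrite -subr_eq0 -/(e t).
apply/negPn/negP => et0.
have ce : {for t, continuous e}.
  apply: cvgB; first exact: cg.
  apply: cvgD; last exact: cvg_cst.
  by apply: cvgMr; exact: cvg_id.
have [d d0 dP] := continuous_eps_delta ce (e := `|e t|) ltac:(by rewrite normr_gt0).
have [a ea ta] : exists2 a, e a = 0 & `|t - a| <= d / 2.
  apply: (halving_dense (P := [set a | e a = 0])) => //=.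
  - move=> a b ea eb; have := eD (a - b) b; rewrite subrK; lra.
  - by move=> a ea; have := eh a; lra.
  - by rewrite divr_gt0.
have := dP a ltac:(lra); by rewrite ea subr0 ltxx.
Qed.

(** * Linear combinations and affine changes of variable *)

Lemma approx_scale (R : realType) (T : set (R -> R)) (a : R) (f : R -> R) :
  approx_class T -> T f -> T (fun x => a * f x).
Proof.
move=> aT Tf; rewrite (_ : (fun x => _) = (fun x => a * x + 0) \o f).
  by apply: approx_comp => //; exact: approx_affine.
by apply/funext => x /=; rewrite addr0.
Qed.

Lemma approx_precomp_affine (R : realType) (T : set (R -> R)) (a b : R) (f : R -> R) :
  approx_class T -> T f -> T (fun x => f (a * x + b)).
Proof.
by move=> aT Tf; apply: (approx_comp aT Tf); exact: approx_affine.
Qed.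

Lemma approx_sub (R : realType) (T : set (R -> R)) (f h : R -> R) :
  approx_class T -> T f -> T h -> T (fun x => f x - h x).
Proof.
move=> aT Tf Th; rewrite (_ : (fun x => _) = f \+ (fun x => -1 * h x)).
  by apply: approx_add => //; exact: approx_scale.
by apply/funext => x /=; rewrite mulN1r.
Qed.

Lemma approx_sum (R : realType) (T : set (R -> R)) (n : nat) (f : nat -> R -> R) :
  approx_class T -> (forall i, T (f i)) -> T (fun x => \sum_(i < n) f i x).
Proof.
move=> aT Tf; elim: n => [|n IH].
  rewrite (_ : (fun x => _) = fun x => 0 * x + 0); first exact: approx_affine.
  by apply/funext => x; rewrite big_ord0 mul0r addr0.
rewrite (_ : (fun x => _) = (fun x => \sum_(i < n) f i x) \+ f n).
  exact: approx_add.
by apply/funext => x; rewrite big_ord_recr.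
Qed.

(** * Averages of translates, and the square function *)

(** A Riemann sum for the average of f over [x, x + 1]. *)
Definition translate_mean (R : realType) (N : nat) (f : R -> R) (x : R) : R :=
  N%:R^-1 * \sum_(i < N) f (x + i%:R / N%:R).

Lemma approx_translate_mean (R : realType) (T : set (R -> R)) (N : nat) (f : R -> R) :
  approx_class T -> T f -> T (translate_mean N f).
Proof.
move=> aT Tf; suff TN : T (fun x => \sum_(i < N) f (x + i%:R / N%:R)).
  exact: (@approx_scale _ _ N%:R^-1 _ aT TN).
have Ti i : T (fun x => f (x + i%:R / N%:R)).
  have := @approx_precomp_affine _ _ 1 (i%:R / N%:R) _ aT Tf.
  by under eq_fun do rewrite mul1r.
exact: (@approx_sum _ _ N (fun i x => f (x + i%:R / N%:R)) aT Ti).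
Qed.

(** The sum telescopes; this is the discrete form of the fact that the average
    of f over [x, x + 1] has derivative f (x + 1) - f x. *)
Lemma translate_mean_diff (R : realType) (N : nat) (f : R -> R) (x : R) :
  (0 < N)%N ->
  translate_mean N f (x + N%:R^-1) - translate_mean N f x = N%:R^-1 * (f (x + 1) - f x).
Proof.
case: N => // N _; rewrite /translate_mean -mulrBr; congr (_ * _).
rewrite big_ord_recr [X in _ - X]big_ord_recl /= mul0r addr0.
have N0 : N%:R + 1 != 0 :> R by rewrite natr1 pnatr_eq0.
rewrite (_ : x + _ + N%:R / _ = x + 1); last by rewrite -natr1; field.
under eq_bigr => i _.
  rewrite (_ : x + _ + _ = x + (bump 0 i)%:R / N.+1%:R); last first.
    by rewrite /bump /= natrD -natr1; field.
  over.
by rewrite /=; ring.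
Qed.

(** Averaging does not worsen a modulus of continuity. *)
Lemma translate_mean_dist (R : realType) (N : nat) (f : R -> R) (x y e : R) :
  (0 < N)%N -> (forall s, 0 <= s <= 1 -> `|f (x + s) - f (y + s)| <= e) ->
  `|translate_mean N f x - translate_mean N f y| <= e.
Proof.
move=> N0 H; have NR : 0 < N%:R :> R by rewrite ltr0n.
rewrite /translate_mean -mulrBr -sumrB normrM gtr0_norm ?invr_gt0 //.
rewrite -ler_pdivlMl ?invr_gt0 // invrK.
apply: le_trans (ler_norm_sum _ _ _) _.
apply: (@le_trans _ _ (\sum_(i < N) e)); last by rewrite sumr_const card_ord mulr_natl.
apply: ler_sum => i _; apply: H.
by rewrite divr_ge0 // ler_pdivrMr // mul1r ler_nat ltnW.
Qed.

(** Discrete Taylor estimate: summing the second differences once bounds the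
    increments by k r, summing again bounds E by k^2 r. *)
Lemma second_difference_bound (R : realType) (E : nat -> R) (r : R) (n : nat) :
  E 0%N = 0 -> E 1%N = 0 -> 0 <= r ->
  (forall j, (j < n)%N -> `|E j.+2 - 2 * E j.+1 + E j| <= r) ->
  `|E n| <= n%:R ^+ 2 * r.
Proof.
move=> E0 E1 r0 H.
suff K k : (k <= n)%N -> `|E k| <= k%:R ^+ 2 * r /\ `|E k.+1 - E k| <= k%:R * r.
  by have [] := K n (leqnn n).
elim: k => [_|k IH kn]; first by rewrite E0 E1 subrr normr0 expr0n !mul0r.
have [h1 h2] := IH (ltnW kn); have h3 := H k kn.
have k0 : 0 <= k%:R :> R by [].
rewrite -natr1; split.
  have -> : E k.+1 = (E k.+1 - E k) + E k by ring.
  apply: le_trans (ler_normD _ _) _; nra.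
have -> : E k.+2 - E k.+1 = (E k.+2 - 2 * E k.+1 + E k) + (E k.+1 - E k) by ring.
by apply: le_trans (ler_normD _ _) _; lra.
Qed.

(** Up to an affine term, c/2 y^2 is approximated near 0 with an error that is
    small compared to s^2, the order of c/2 y^2 itself, so that rescaling [0, s]
    to a fixed interval keeps the error small.  First s is chosen so that the
    second difference D of g is close to c on [0, s]; then N, so large that the
    double average F of g hardly varies over a step 1/N.  On the grid of step
    1/N the second differences of F are D / N^2, and the discrete Taylor
    estimate compares F with c/2 y^2; a point y is handled through the last grid
    point u before it. *)
Lemma approx_local_square (R : realType) (T : set (R -> R)) (g : R -> R) (c e : R) :
  approx_class T -> T g -> continuous g -> c = g 2 - 2 * g 1 + g 0 -> 0 < e ->
  exists2 s : R, 0 < s & exists2 F, T F &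
    forall y, 0 <= y <= s -> `|F y - c / 2 * y ^+ 2| <= e * s ^+ 2.
Proof.
move=> aT Tg cg cE e0.
pose D x := g (x + 2) - 2 * g (x + 1) + g x.
have cD : {for 0, continuous D}.
  have ct a : continuous (fun x => g (x + a)).
    move=> x; apply: (@continuous_comp _ _ _ (fun x => x + a) g); last exact: cg.
    by apply: cvgD; [exact: cvg_id | exact: cvg_cst].
  apply: cvgD; last exact: cg.
  apply: cvgB; first exact: ct.
  by apply: cvgMr; exact: ct.
have e20 : 0 < e / 2 by rewrite divr_gt0.
have [d1 d10 d1P] := continuous_eps_delta cD e20.
pose s := Num.min (d1 / 2) 1.
have s0 : 0 < s by rewrite lt_min divr_gt0 // ltr01.
have s1 : s <= 1 by rewrite ge_min lexx orbT.
have sd1 : s <= d1 / 2 by rewrite ge_min lexx.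
have DP x : 0 <= x <= s -> `|D x - c| <= e / 2.
  move=> /andP[x0 xs]; have : `|D 0 - D x| < e / 2.
    by apply: d1P; rewrite sub0r normrN ger0_norm; lra.
  by rewrite distrC /D !add0r -cE => /ltW.
have es0 : 0 < e * s ^+ 2 / 8 by rewrite divr_gt0 // mulr_gt0 // exprn_gt0.
(* The double average at a point of [0, 1] samples g within [0, 3]. *)
have [d2 d20 d2P] := continuous_compact_unif cg (@segment_compact _ 0 3) es0.
(* N > b ensures both 1/N < d2 and 12 |c| / N <= e s^2. *)
pose b := d2^-1 + 12 * (`|c| + 1) / (e * s ^+ 2).
have [N N0 Nb] : exists2 N, (0 < N)%N & b < N%:R :> R.
  by exists (Num.truncn b).+1 => //; exact: truncnS_gt.
have NR : 0 < N%:R :> R by rewrite ltr0n.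
pose n1 : R := N%:R^-1.
have n10 : 0 < n1 by rewrite invr_gt0.
have nN : n1 * N%:R = 1 by rewrite mulVf // gt_eqF.
have n1d2 : n1 < d2.
  rewrite -[d2]invrK ltf_pV2 ?posrE ?invr_gt0 //; apply: le_lt_trans Nb.
  by rewrite lerDl divr_ge0 ?mulr_ge0 ?addr_ge0 ?exprn_ge0 // ltW.
have n1c : n1 * (12 * `|c|) <= e * s ^+ 2.
  have es1 : 0 < e * s ^+ 2 by rewrite mulr_gt0 // exprn_gt0.
  have : 12 * (`|c| + 1) / (e * s ^+ 2) <= N%:R.
    by apply/ltW/(le_lt_trans _ Nb); rewrite /b lerDr invr_ge0 ltW.
  rewrite ler_pdivrMr // -(ler_pM2l n10) mulrA [n1 * (N%:R * _)]mulrA nN; lra.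
pose F := translate_mean N (translate_mean N g).
have F_dist x y : 0 <= x <= 1 -> `|x - y| <= n1 -> `|F x - F y| <= e * s ^+ 2 / 8.
  move=> /andP[x0 x1] xy; apply: translate_mean_dist => // t /andP[t0 t1].
  apply: translate_mean_dist => // u /andP[u0 u1].
  apply: d2P; first by rewrite /= in_itv /=; lra.
  rewrite (_ : _ - _ = x - y); [exact: le_lt_trans n1d2 | ring].
have F_diff2 x : F (x + n1 + n1) - 2 * F (x + n1) + F x = n1 ^+ 2 * D x.
  have := @translate_mean_diff _ N (translate_mean N g) (x + n1) N0.
  have := @translate_mean_diff _ N (translate_mean N g) x N0.
  have := @translate_mean_diff _ N g (x + 1) N0.
  have := @translate_mean_diff _ N g x N0.
  rewrite -/n1 -/F (_ : x + n1 + 1 = x + 1 + n1); last by ring.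
  rewrite (_ : x + 1 + 1 = x + 2); last by ring.
  move=> h1 h2 h3 h4.
  have -> : F (x + n1 + n1) - 2 * F (x + n1) + F x =
    (F (x + n1 + n1) - F (x + n1)) - (F (x + n1) - F x) by ring.
  rewrite h3 h4 /D.
  set G := translate_mean N g in h1 h2 *.
  have -> : n1 * (G (x + 1 + n1) - G (x + n1)) - n1 * (G (x + 1) - G x) =
    n1 * ((G (x + 1 + n1) - G (x + 1)) - (G (x + n1) - G x)) by ring.
  by rewrite h1 h2; ring.
pose beta := F n1 - F 0.
have beta_le : `|beta| <= e * s ^+ 2 / 8.
  by rewrite distrC; apply: F_dist; rewrite ?lexx ?ler01 // sub0r normrN gtr0_norm.
exists s => //; exists (fun y => F y - (beta * N%:R * y + F 0)).
  apply: approx_sub => //; last exact: approx_affine.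
  by do 2!apply: approx_translate_mean => //.
move=> y /andP[y0 ys].
have yN0 : 0 <= y * N%:R by rewrite mulr_ge0.
have /andP[ky yk] := truncn_itv yN0.
set k := Num.truncn (y * N%:R) in ky yk.
pose u := k%:R * n1.
have u0 : 0 <= u by rewrite mulr_ge0 // ltW.
have uy : u <= y by rewrite /u ler_pdivrMr.
have yu : y - u <= n1.
  rewrite lerBlDl /u -[X in _ + X]mul1r -mulrDl natr1 -/n1.
  by rewrite ler_pdivlMr // ltW.
(* The quadratic sequence j (j - 1) vanishes at 0 and 1 and has constant second
   difference 2, so E starts with two zeros. *)
pose E (j : nat) := F (j%:R * n1) - F 0 - j%:R * beta - c / 2 * (j%:R * (j%:R - 1)) * n1 ^+ 2.
have Ek : `|E k| <= e / 2 * s ^+ 2.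
  apply: (@le_trans _ _ (k%:R ^+ 2 * (n1 ^+ 2 * (e / 2)))).
    apply: second_difference_bound.
    - by rewrite /E mul0r; ring.
    - by rewrite /E mul1r /beta; ring.
    - by rewrite mulr_ge0 ?exprn_ge0 ?ltW.
    move=> j jk.
    have jn0 : 0 <= j%:R * n1 by rewrite mulr_ge0 // ltW.
    have jn : j%:R * n1 <= s.
      by apply: le_trans ys; apply: le_trans uy; rewrite /u ler_pM2r // ler_nat ltnW.
    have -> : E j.+2 - 2 * E j.+1 + E j = n1 ^+ 2 * (D (j%:R * n1) - c).
      rewrite [RHS]mulrBr -F_diff2 /E -!natr1.
      have -> : (j%:R + 1 + 1) * n1 = j%:R * n1 + n1 + n1 by ring.
      have -> : (j%:R + 1) * n1 = j%:R * n1 + n1 by ring.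
      by field.
    have n20 : 0 < n1 ^+ 2 by rewrite exprn_gt0.
    by rewrite normrM gtr0_norm // ler_pM2l // DP // jn0.
  rewrite mulrA -exprMn -/u mulrC ler_pM2l // lerXn2r ?nnegrE //; lra.
have Fyu : `|F y - F u| <= e * s ^+ 2 / 8.
  by apply: F_dist; rewrite ?ger0_norm ?subr_ge0 //; lra.
have -> : F y - (beta * N%:R * y + F 0) - c / 2 * y ^+ 2 =
    (F y - F u) + E k + (- (beta * (N%:R * (y - u)))) +
    (- (c / 2 * ((y - u) * (y + u) + u * n1))).
  rewrite /E -/u.
  have kE : k%:R = u * N%:R by rewrite /u -mulrA nN mulr1.
  rewrite kE.
  have -> : c / 2 * (u * N%:R * (u * N%:R - 1)) * n1 ^+ 2 =
    c / 2 * (u * (n1 * N%:R) * (u * (n1 * N%:R) - n1)) by ring.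
  rewrite nN; ring.
have h3 : `|- (beta * (N%:R * (y - u)))| <= e * s ^+ 2 / 8.
  rewrite normrN normrM -[leRHS]mulr1; apply: ler_pM => //.
  rewrite ger0_norm ?mulr_ge0 ?subr_ge0 //.
  by rewrite (@le_trans _ _ (N%:R * n1)) ?ler_pM2l // mulrC nN.
have h4 : `|- (c / 2 * ((y - u) * (y + u) + u * n1))| <= e * s ^+ 2 / 8.
  rewrite normrN normrM normrM [`|2^-1|]gtr0_norm ?invr_gt0 //.
  have q0 : 0 <= (y - u) * (y + u) + u * n1.
    by apply: addr_ge0; apply: mulr_ge0; lra.
  have q1 : (y - u) * (y + u) + u * n1 <= 3 * n1 by nra.
  rewrite (ger0_norm q0); have := normr_ge0 c; nra.
apply: le_trans (ler_normD _ _) _; apply: le_trans (lerD (ler_normD _ _) h4) _.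
apply: le_trans (lerD (lerD (ler_normD _ _) h3) (lexx _)) _; lra.
Qed.

(** Move a nonzero second difference of g to 0, 1, 2 by an affine change of
    variable, then carry [-L, L] onto [0, s] by a second one: (x + L)^2 is
    obtained from the local approximation, and differs from x^2 by an affine
    function. *)
Lemma approx_sqr (R : realType) (T : set (R -> R)) (g : R -> R) :
  approx_class T -> T g -> continuous g -> ~ affine g -> T (fun x => x ^+ 2).
Proof.
move=> aT Tg cg ng.
have [t [h]] := exists_second_difference_neq0 cg ng.
set c := _ + g t => c0; have cn : 0 < `|c| by rewrite normr_gt0.
pose f x := g (h * x + t).
have Tf : T f := approx_precomp_affine h t aT Tg.
have cf : continuous f.
  move=> x; apply: (@continuous_comp _ _ _ (fun x => h * x + t) g); last exact: cg.
  by apply: cvgD; [apply: cvgMr; exact: cvg_id | exact: cvg_cst].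
have cE : c = f 2 - 2 * f 1 + f 0.
  by rewrite /c /f mulr1 mulr0 add0r ![_ + t]addrC [h * 2]mulrC.
apply: (approx_closed aT) => M e e0.
(* The factor a below turns an error (e |c| / 8 L^2) s^2 into e. *)
pose L := `|M| + 1; have L0 : 0 < L by rewrite ltr_wpDl.
have e10 : 0 < e * `|c| / (8 * L ^+ 2) by rewrite !(divr_gt0, mulr_gt0, exprn_gt0).
have [s s0 [F TF FP]] := approx_local_square aT Tf cf cE e10.
pose a := 8 * L ^+ 2 / (c * s ^+ 2).
exists (fun x => a * F (s / (2 * L) * x + s / 2) - (2 * L * x + L ^+ 2)).
  apply: approx_sub => //; last exact: approx_affine.
  apply: (@approx_scale _ _ a (fun x => F (s / (2 * L) * x + s / 2))) => //.
  exact: (approx_precomp_affine _ _ aT TF).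
move=> x xM; set y := s / (2 * L) * x + s / 2.
have yE : y = s / (2 * L) * (x + L) by rewrite /y; field; rewrite gt_eqF.
have /andP[xL Lx] : - L <= x <= L.
  rewrite -ler_norml; apply: le_trans xM _; rewrite /L; have := ler_norm M; lra.
have ys : 0 <= y <= s.
  have sL : 0 < s / (2 * L) by rewrite divr_gt0 // mulr_gt0.
  rewrite yE mulr_ge0 ?(ltW sL) //=; last lra.
  by rewrite mulrAC ler_pdivrMr ?mulr_gt0 // ler_pM2l //; lra.
have -> : x ^+ 2 - (a * F y - (2 * L * x + L ^+ 2)) = - (a * (F y - c / 2 * y ^+ 2)).
  by rewrite yE /a; field; rewrite c0 !gt_eqF.
rewrite normrN normrM.
have a0 : 0 < `|a| by rewrite normr_gt0 !(mulf_neq0, invr_neq0) // ?expf_neq0 ?gt_eqF.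
apply: le_trans (ler_wpM2l (ltW a0) (FP y ys)) _.
rewrite /a normrM normfV [`|c * _|]normrM [`|8 * _|]gtr0_norm ?mulr_gt0 ?exprn_gt0 //.
rewrite [`|s ^+ 2|]gtr0_norm ?exprn_gt0 //.
suff -> : 8 * L ^+ 2 / (`|c| * s ^+ 2) * (e * `|c| / (8 * L ^+ 2) * s ^+ 2) = e by [].
by field; rewrite !gt_eqF.
Qed.

(** * The absolute value *)

(** Newton-like iteration for the square root of x^2; it uses only squares and
    linear combinations. *)
Fixpoint abs_iter (R : realType) (n : nat) (x : R) : R :=
  if n is m.+1 then abs_iter m x + (x ^+ 2 - abs_iter m x ^+ 2) / 2 else 0.

Lemma approx_abs_iter (R : realType) (T : set (R -> R)) (n : nat) :
  approx_class T -> T (fun x => x ^+ 2) -> T (abs_iter n).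
Proof.
move=> aT T2; elim: n => [|n IH].
  rewrite (_ : abs_iter 0 = fun x => 0 * x + 0); first exact: approx_affine.
  by apply/funext => x; rewrite mul0r addr0.
have Tn2 : T (fun x => x ^+ 2 - abs_iter n x ^+ 2).
  by apply: approx_sub => //; exact: (approx_comp aT T2 IH).
rewrite (_ : abs_iter n.+1 = abs_iter n \+ fun x => 2^-1 * (x ^+ 2 - abs_iter n x ^+ 2)).
  by apply: approx_add => //; exact: (approx_scale 2^-1 aT Tn2).
by apply/funext => x /=; rewrite [2^-1 * _]mulrC.
Qed.

(** With d = |x| - abs_iter n x, the next error is d (1 - (|x| + abs_iter n x) / 2),
    at most d (1 - d / 2), which turns a bound 2/q into 2/(q + 1). *)
Lemma abs_iter_bound (R : realType) (n : nat) (x : R) : `|x| <= 1 ->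
  0 <= abs_iter n x <= `|x| /\ `|x| - abs_iter n x <= 2 / n.+1%:R.
Proof.
move=> x1; have x0 := normr_ge0 x.
elim: n => [|n [/andP[p0 px] pn]] /=; first by rewrite lexx x0; split => //; lra.
rewrite -(real_normK (num_real x)).
move: p0 px pn; set p := abs_iter n x; set v := `|x| in x0 x1 *.
rewrite -[n.+2%:R]natr1; set q : R := n.+1%:R => p0 px pn.
have q0 : 0 < q by rewrite ltr0n.
split; first by apply/andP; split; nra.
have dE : v - (p + (v ^+ 2 - p ^+ 2) / 2) <= (v - p) * (1 - (v - p) / 2) by nra.
apply: le_trans dE _; have [d1|d1] := leP (v - p) (2 / (q + 1)).
  by apply: le_trans d1; nra.
(* Here 2 / (q + 1) < v - p <= 2 / q, so each factor is bounded separately. *)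
have -> : 2 / (q + 1) = 2 / q * (1 - (2 / (q + 1)) / 2) by field; lra.
by apply: ler_pM => //; lra.
Qed.

Lemma approx_abs (R : realType) (T : set (R -> R)) :
  approx_class T -> T (fun x => x ^+ 2) -> T (fun x => `|x|).
Proof.
move=> aT T2; apply: (approx_closed aT) => M e e0.
pose L := `|M| + 1; have L0 : 0 < L by rewrite ltr_wpDl.
pose n := Num.truncn (2 * L / e).
have ne : 2 * L / e < n.+1%:R := truncnS_gt _.
exists (fun x => L * abs_iter n (L^-1 * x + 0)).
  apply: (@approx_scale _ _ _ (fun x => abs_iter n (L^-1 * x + 0))) => //.
  exact: (approx_precomp_affine _ _ aT (approx_abs_iter n aT T2)).
move=> x xM; rewrite addr0; set y := L^-1 * x.
have xE : x = L * y by rewrite /y mulrA mulfV ?mul1r // gt_eqF.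
have y1 : `|y| <= 1.
  rewrite /y normrM gtr0_norm ?invr_gt0 // mulrC ler_pdivrMr // mul1r.
  by apply: le_trans xM _; rewrite /L; have := ler_norm M; lra.
have [/andP[_ py] yp] := abs_iter_bound n y1.
rewrite {1}xE normrM (gtr0_norm L0) -mulrBr normrM (gtr0_norm L0) ger0_norm ?subr_ge0 //.
apply: le_trans (ler_wpM2l (ltW L0) yp) _.
by rewrite mulrA ler_pdivrMr ?ltr0n // [L * 2]mulrC [e * _]mulrC -ler_pdivrMr // ltW.
Qed.

Lemma approx_min (R : realType) (T : set (R -> R)) (f h : R -> R) :
  approx_class T -> T (fun x => `|x|) -> T f -> T h ->
  T (fun x => Num.min (f x) (h x)).
Proof.
move=> aT Ta Tf Th; have Tfh := approx_sub aT Tf Th.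
have Tm := approx_sub aT (approx_add aT Tf Th) (approx_comp aT Ta Tfh).
have := approx_scale 2^-1 aT Tm.
by congr T; apply/funext => x /=; rewrite minr_absE mulrC.
Qed.

(** * Approximation on compact sets *)

(** For each x in K, a cone of vertex (x, f x) and slope large enough stays above
    f - e on K, and is below f + e near x.  Taking minima of finitely many such
    cones is expressed by a filter: the approximants above f - e are directed
    downwards by minima, and being eventually below f + e along this filter is
    a local property, so it holds on the whole of K by compactness. *)
Lemma approx_compact (R : realType) (T : set (R -> R)) (K : set R) (f : R -> R) (e : R) :
  approx_class T -> T (fun x => `|x|) -> compact K -> {within K, continuous f} ->
  0 < e -> exists2 F, T F & forall x, K x -> `|f x - F x| <= e.
Proof.
move=> aT Ta cK cf e0; have e20 : 0 < e / 2 by rewrite divr_gt0.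
have [B B0 fB] : exists2 B, 0 < B & forall x, K x -> `|f x| <= B.
  have /compact_bounded [B [_ /(_ (`|B| + 1))]] := continuous_compact cf cK.
  rewrite (le_lt_trans (ler_norm B)) ?ltrDl // => /(_ isT) H.
  by exists (`|B| + 1) => [|x Kx]; [rewrite ltr_wpDl | apply: H; exists x].
have fd x : K x -> exists2 d, 0 < d &
    forall z, K z -> `|x - z| < d -> `|f x - f z| < e / 2.
  move=> Kx; have /subspace_continuousP/(_ x Kx)/cvgrPdist_lt/(_ _ e20) := cf.
  move=> /nbhs_ballP[d /= d0 dP]; exists d => // z Kz xz; exact: dP.
pose above := [set F | T F /\ forall x, K x -> f x - e <= F x].
pose below F := [set G | above G /\ forall x, G x <= F x].
have FF : Filter (filter_from above below).
  apply: filter_from_filter.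
    exists (fun x => 0 * x + B); split; first exact: approx_affine.
    by move=> x Kx; have := fB x Kx; have := ler_norm (f x); lra.
  move=> F G [TF aF] [TG aG]; exists (fun x => Num.min (F x) (G x)).
    split; first exact: approx_min.
    by move=> x Kx; rewrite le_min aF ?aG.
  move=> H [aH HFG]; split; split=> // x; have := HFG x; rewrite le_min => /andP[] //.
have /compact_near_coveringP/near_covering_withinP cov := cK.
have [x Kx|F [TF aF] FP] := cov _ _ (fun G x => G x <= f x + e) FF.
  have [d d0 dP] := fd x Kx.
  (* Beyond distance d from x, the cone is above f x + 2 B, hence above f. *)
  pose L := 2 * B / d; have L0 : 0 < L by rewrite divr_gt0 // mulr_gt0.
  pose C y := f x + L * `|y - x|.
  exists ([set y | `|x - y| < Num.min d (e / 2 / L)], below C) => /=.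
    split.
      apply/nbhs_ballP; exists (Num.min d (e / 2 / L)) => //=.
      by rewrite lt_min d0 divr_gt0.
    exists C => //; split.
      have Tx : T (fun y => `|y - x|).
        have := approx_precomp_affine 1 (- x) aT Ta.
        by congr T; apply/funext => y; rewrite mul1r.
      have := approx_add aT (approx_affine aT 0 (f x)) (approx_scale L aT Tx).
      by congr T; apply/funext => y /=; rewrite mul0r add0r.
    move=> y Ky; rewrite /C; have [yd|yd] := ltP `|x - y| d.
      have := dP y Ky yd; rewrite ltr_distl => /andP[h1 h2].
      have : 0 <= L * `|y - x| by rewrite mulr_ge0 // ltW.
      lra.
    have : 2 * B <= L * `|y - x|.
      by rewrite distrC -[leLHS](divfK (lt0r_neq0 d0)) ler_pM2l.
    have := fB x Kx; have := fB y Ky; rewrite !ler_norml => /andP[? ?] /andP[? ?].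
    lra.
  move=> [y G] /= [xy [aG GC]] Ky; apply: le_trans (GC y) _; rewrite /C.
  move: xy; rewrite lt_min => /andP[xyd xyL].
  have := dP y Ky xyd; rewrite ltr_distl => /andP[h1 h2].
  have : L * `|y - x| <= e / 2 by rewrite distrC mulrC -ler_pdivlMr // ltW.
  lra.
exists F => // x Kx; have := FP F; rewrite /= => /(_ _ x Kx) h.
have := aF x Kx; have {}h := h ltac:(by []).
by rewrite ler_distl => h1; apply/andP; split; lra.
Qed.

Theorem theorem2p1 (R : realType) (g1 g2 : R -> R)
    (hg1_cont : continuous g1) (hg1_naff : ~ affine g1)
    (hg2 : forall t : R, g2 t = 1 - t / 2) :
  forall K : set R, compact K ->
  forall f : R -> R, {within K, continuous f} ->
  forall eps : R, 0 < eps ->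
  exists F : R -> R,
    add_comp_class g1 g2 F /\ (unif_dist K f F < eps%:E)%E.
Proof.
move=> K cK f cf e e0; have e30 : 0 < e / 3 by rewrite divr_gt0.
have aT := add_comp_class_approx_class hg1_cont hg2.
have Tg1 : luc_closure (add_comp_class g1 g2) g1.
  by apply: subset_luc_closure; apply: sub_gen_smallest; left.
have Tabs := approx_abs aT (approx_sqr aT Tg1 hg1_cont hg1_naff).
have [G TG fG] := approx_compact aT Tabs cK cf e30.
have [M KM] : exists M, forall x, K x -> `|x| <= M.
  have [M [_ /(_ (M + 1))]] := compact_bounded cK.
  by rewrite ltrDl ltr01 => /(_ isT) KM; exists (M + 1).
have [F SF GF] := TG M _ e30.
exists F; split => //; apply: (@le_lt_trans _ _ (2 * e / 3)%:E).
  apply: ge_ereal_sup => _ [x Kx <-]; rewrite lee_fin.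
  have := ler_distD (G x) (f x) (F x); have := fG x Kx; have := GF x (KM x Kx); lra.
rewrite lte_fin; lra.
Qed.
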